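(* Let $c$ be a random variable with values in $[0,1]$, let $(c_n)_{n\ge 0}$ be i.i.d. copies of $c$, independent of $r_0\sim\mathcal{U}(0,1)$, and define $r_{n+1}=T(c_n,r_n)$ and $\ell_{n+1}=\ell(c_n,r_n)$ for $n\ge 0$, with $T$ and $\ell$ as given in the context. Among all distributions of $c$ on $[0,1]$, the expected contraction factor $\mathbb{E}[\ell_n]$ is minimized uniquely by the classical bisection algorithm: for every $n\ge 1$ one has $\mathbb{E}[\ell_n]\ge\tfrac12$, with equality if and only if $c=\tfrac12$ almost surely.
   Context: $\mathcal{U}(0,1)$ is the uniform distribution on $(0,1)$. For $c,r\in[0,1]$, $$T(c,r)=\begin{cases}\dfrac{r}{c} & \text{if } c\ge r,\\[2mm] \dfrac{r-c}{1-c} & \text{if } c<r,\end{cases}\qquad \ell(c,r)=\begin{cases} c & \text{if } c\ge r,\\ 1-c & \text{if } c<r,\end{cases}$$ with the convention $T(0,0)=0$. Here $r_n$ is the relative position of the root in the current interval (rescaled to $[0,1]$), $c_n$ the relative position of the random cut, and $\ell_{n+1}$ the factor by which the interval length is multiplied at that step of the stochastic bisection method. The classical bisection algorithm is the case $c=\tfrac12$ almost surely. *)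

(* Defs.v *)
From HB Require Import structures.
From mathcomp Require Import all_boot all_order all_algebra finmap.
From mathcomp Require Import all_classical all_reals all_analysis.

Set Implicit Arguments.
Unset Strict Implicit.
Unset Printing Implicit Defensive.

Import Order.TTheory GRing.Theory Num.Theory.
Import numFieldNormedType.Exports.

Local Open Scope classical_set_scope.
Local Open Scope ring_scope.

(* Only the values at c, r in [0, 1] are meaningful.  The convention
   T(0, 0) = 0 holds because x / 0 = 0 in a MathComp field; the other division
   by zero, c = 1 in the second branch, needs r > 1. *)
Definition bisect_pos {R : realType} (c r : R) : R :=
  if r <= c then r / c else (r - c) / (1 - c).

Definition bisect_factor {R : realType} (c r : R) : R :=
  if r <= c then c else 1 - c.

Definition sigma_of_RV {R : realType} {d d' : measure_display}
    {T : measurableType d} {T' : measurableType d'} {P : probability T R}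
    (X : {RV P >-> T'}) : set (set T) :=
  preimage_set_system setT X measurable.

Definition sigma_of_RVs {R : realType} {d d' : measure_display}
    {T : measurableType d} {T' : measurableType d'} {P : probability T R}
    {I : Type} (X : I -> {RV P >-> T'}) : set (set T) :=
  <<s \bigcup_i sigma_of_RV (X i) >>.

Definition mutually_independent {R : realType} {d d' : measure_display}
    {T : measurableType d} {T' : measurableType d'} (P : probability T R)
    {I : choiceType} (X : I -> {RV P >-> T'}) : Prop :=
  forall (J : {fset I}) (A : I -> set T'),
    (forall i, i \in J -> measurable (A i)) ->
    P (\bigcap_(i in [set` J]) X i @^-1` A i) =
    (\prod_(i <- J) P (X i @^-1` A i))%E.

Definition independent_systems {R : realType} {d : measure_display}
    {T : measurableType d} (P : probability T R) (F G : set (set T)) : Prop :=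
  forall A B, F A -> G B -> P (A `&` B) = (P A * P B)%E.

(* Main.v *)
Require Import Defs.
From HB Require Import structures.
From mathcomp Require Import all_boot all_order all_algebra finmap.
From mathcomp Require Import all_classical all_reals all_analysis.
From mathcomp Require Import measurable_realfun ring.

Import Order.TTheory GRing.Theory Num.Theory.
Import numFieldNormedType.Exports.

Local Open Scope classical_set_scope.
Local Open Scope ring_scope.

(** The uniform law is stationary: for each fixed cut [c] in [[0, 1]], a uniform
    position falls in the piece [[0, c]] with probability [c] and in [(c, 1]]
    with probability [1 - c], it is uniform in the piece where it falls, and
    [bisect_pos c] rescales this piece to unit length.  So [bisect_pos c]
    preserves the uniform law ([uniform_bisect_pos]).

    The image law is therefore the same for every value of the cut.  Hence, if
    the current position is uniform and independent of the sigma-algebra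
    generated by the whole sequence of cuts, then so is the next position:
    conditionally on all the cuts, it is the image of a uniform variable by a
    fixed uniform-preserving map.  Induction gives this for every [r n]
    ([pos_uniform_indep]).

    Since [r n] is uniform and independent of [c_ n], integrating over [r n]
    first ([integral_freezing]) gives
      [E (l n.+1) = E (c * c + (1 - c) * (1 - c))],
    because the piece of length [c] is kept with probability [c] and the other
    one with probability [1 - c] ([expectation_factor]).  Finally
      [c ^+ 2 + (1 - c) ^+ 2 = 1/2 + 2 * (c - 1/2) ^+ 2],
    so the expectation exceeds 1/2 by twice the mean square distance of the cut
    to the midpoint, which vanishes exactly when the cut is almost surely the
    midpoint ([integral_square_gap]). *)

Set Implicit Arguments.
Unset Strict Implicit.
Unset Printing Implicit Defensive.

(** * Measurability of the bisection maps *)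

Lemma measurable_funV_real (R : realType) :
  measurable_fun [set: R] (fun x : R => x^-1).
Proof.
rewrite -(setvU [set (0 : R)]) setUC; apply/measurable_funU => //.
  exact: measurableC.
split; first exact: measurable_fun_set1.
apply: open_continuous_measurable_fun.
  by apply: closed_openC; exact: closed_eq.
by move=> x /[!inE]/= /eqP x0; exact: inv_continuous.
Qed.

Lemma measurable_bisect_pos (R : realType) :
  measurable_fun [set: R * R] (fun p : R * R => bisect_pos p.1 p.2).
Proof.
apply: measurable_fun_ifT.
- exact: measurable_fun_ler.
- apply: measurable_funM => //.
  by apply: measurableT_comp; [exact: measurable_funV_real|exact: measurable_fst].
- apply: measurable_funM; first exact: measurable_funB.
  apply: measurableT_comp; first exact: measurable_funV_real.
  exact: measurable_funB.
Qed.

Lemma measurable_bisect_factor (R : realType) :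
  measurable_fun [set: R * R] (fun p : R * R => bisect_factor p.1 p.2).
Proof.
apply: measurable_fun_ifT => //; first exact: measurable_fun_ler.
exact: measurable_funB.
Qed.

(** * The uniform law is preserved by a cut *)

Lemma uniform_prob01E (R : realType) (A : set R) :
  measurable A ->
  uniform_prob (@ltr01 R) A = lebesgue_measure (A `&` `[0, 1]).
Proof.
move=> mA; rewrite /uniform_prob integral_uniform_pdf.
rewrite (eq_integral (cst 1%E)).
  by rewrite integral_cst ?mul1e//; exact: measurableI.
move=> x /[!inE]-[_]/=; rewrite in_itv/= /uniform_pdf => ->.
by rewrite subr0 invr1.
Qed.
(** The rays [`]-oo, a]] are stable under intersection and generate the Borel
    sets, as [`]a, b]] is a difference of two of them; so a law on the real line
    is determined by its distribution function. *)
Lemma finite_measure_ray_unique (R : realType)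
  (m1 m2 : {measure set R -> \bar R}) :
  (forall a : R, (m1 `]-oo, a]%classic < +oo)%E) ->
  (forall a : R, m1 `]-oo, a]%classic = m2 `]-oo, a]%classic) ->
  forall A : set R, measurable A -> m1 A = m2 A.
Proof.
move=> m1oo m12.
pose G := [set A : set R | exists a, A = `]-oo, a]%classic].
apply: (measure_unique G (fun n => `]-oo, n%:R]%classic)).
- rewrite eqEsubset; split => A; last first.
    apply: smallest_sub; first exact: sigma_algebra_measurable.
    by move=> _ [a ->]; exact: measurable_itv.
  apply: smallest_sub; first exact: smallest_sigma_algebra.
  move=> _ [[a b] _ <-] /=.
  have -> : `]a, b]%classic = `]-oo, b] `\` `]-oo, a] :> set R.
    by rewrite -[RHS]setCK setCD setCitvl setUC -[LHS]setCK setCitv.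
  apply: (@measurableD _ (g_sigma_algebraType G)); apply: sub_sigma_algebra;
    by eexists.
- move=> _ _ [a ->] [b ->]; exists (Num.min a b).
  apply/seteqP; split => x /=; rewrite !in_itv/= le_min.
    by move=> [-> ->].
  by move=> /andP.
- by move=> n; eexists.
- apply/seteqP; split => // x _; exists (Num.truncn x).+1 => //=.
  by rewrite in_itv/= ltW// truncnS_gt.
- by move=> _ [a ->]; exact: m12.
- by move=> n; exact: m1oo.
Qed.

Lemma bisect_pos01 (R : realType) (c r : R) :
  0 <= c <= 1 -> 0 <= r <= 1 -> 0 <= bisect_pos c r <= 1.
Proof.
move=> /andP[c0 c1] /andP[r0 r1]; rewrite /bisect_pos; case: (leP r c) => rc.
  rewrite divr_ge0//=; move: c0; rewrite le_eqVlt => /predU1P[<-|c0].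
    by rewrite invr0 mulr0.
  by rewrite ler_pdivrMr// mul1r.
have c1' : c < 1 by exact: lt_le_trans rc r1.
by rewrite divr_ge0 ?subr_ge0 ?(ltW rc)//= ler_pdivrMr ?subr_gt0// mul1r lerB.
Qed.

(** Each branch of [bisect_pos c] is affine and increasing, so a sublevel set is
    an initial segment of length [c * a] of the left piece together with one of
    length [(1 - c) * a] of the right piece.  The degenerate cuts [c = 0] and
    [c = 1] obey the same formula; the former uses [r / 0 = 0]. *)
Lemma bisect_pos_le (R : realType) (c r a : R) :
  0 <= c <= 1 -> 0 <= r <= 1 -> 0 <= a < 1 ->
  (bisect_pos c r <= a) =
    (r <= c * a) || (c < r <= c + (1 - c) * a).
Proof.
move=> /andP[c0 c1] /andP[r0 r1] /andP[a0 a1]; rewrite /bisect_pos.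
case: (leP r c) => rc /=.
  rewrite orbF; move: c0; rewrite le_eqVlt => /predU1P[c0|c0].
    by rewrite -c0 invr0 mulr0 mul0r a0; apply/esym; rewrite c0.
  by rewrite ler_pdivrMr// mulrC.
have c1' : c < 1 by exact: lt_le_trans rc r1.
rewrite ler_pdivrMr ?subr_gt0// lerBlDl (mulrC a).
suff -> : (r <= c * a) = false by [].
apply/negbTE; rewrite -ltNge; apply: le_lt_trans rc.
by rewrite ler_piMr// ltW.
Qed.

(** A characterization by values rather than the equality with [uniform_prob]:
    the latter is a measure on [measurableTypeR R], which has the same
    measurable sets as [R] but another display. *)
Definition uniform01 (R : realType) (mu : probability R R) :=
  forall A : set R, measurable A -> mu A = lebesgue_measure (A `&` `[0, 1]).

(** Both laws have the same distribution function: for [0 <= a < 1] the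
    sublevel set has length [c * a + (1 - c) * a = a]. *)
Lemma uniform_bisect_pos (R : realType) (mu : probability R R) (c : R) :
  uniform01 mu -> 0 <= c <= 1 ->
  forall A : set R, measurable A -> mu (bisect_pos c @^-1` A) = mu A.
Proof.
move=> muE c01; have /andP[c0 c1] := c01.
have mT : measurable_fun [set: R] (@bisect_pos R c).
  exact: (measurableT_comp (@measurable_bisect_pos R)
    (measurable_pair1 c)).
have mpre A : measurable A -> measurable (@bisect_pos R c @^-1` A).
  by move=> mA; rewrite -[X in measurable X]setTI; exact: mT.
pose X : {mfun R >-> R} := mfun_Sub (mem_set mT).
apply: (@finite_measure_ray_unique R (distribution mu X) mu).
  by move=> a; rewrite -ge0_fin_numE// fin_num_measure.
move=> a.
have mray : measurable (`]-oo, a]%classic : set R) by [].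
apply: etrans (muE _ (mpre _ mray)) _; apply: etrans (esym (muE _ mray)).
(* Outside [[0, 1[], both sides are trivial as positions stay in [[0, 1]]. *)
have [a0|a0] := ltP a 0.
  congr lebesgue_measure; apply/seteqP; split => x /= [];
     rewrite !in_itv/= => + /andP[x0 x1].
  have /andP[+ _] := @bisect_pos01 _ c x c01 ltac:(by rewrite x0 x1).
  by move=> /le_trans/[apply]; rewrite leNgt a0.
  by move=> /(le_trans x0); rewrite leNgt a0.
have [a1|a1] := leP 1 a.
  congr lebesgue_measure; apply/seteqP; split => x /= [];
     rewrite !in_itv/= => _ /andP[x0 x1]; rewrite x0 x1.
    by rewrite (le_trans x1 a1).
  have /andP[_ /le_trans/(_ a1) ->//] := @bisect_pos01 _ c x c01 ltac:(by rewrite x0 x1).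
have caM : c * a <= c by rewrite ler_piMr// ltW.
have c1a : c + (1 - c) * a <= 1.
  by rewrite -[leRHS](subrKC c) lerD2l ler_piMr ?subr_ge0// ltW.
have c1a0 : c <= c + (1 - c) * a by rewrite lerDl mulr_ge0// subr_ge0.
transitivity (lebesgue_measure (`[0, c * a] `|` `]c, c + (1 - c) * a] : set R)).
  congr lebesgue_measure; apply/seteqP; split => x /=; rewrite !in_itv/=.
    move=> [+ /andP[x0 x1]]; rewrite bisect_pos_le ?x0 ?a0//.
    by move=> /orP[|]; [left|right].
  move=> xA; have x01 : 0 <= x <= 1.
    case: xA => /andP[x0 x1].
      by rewrite x0/=; apply: le_trans x1 (le_trans caM c1).
    by rewrite (le_trans c0 (ltW x0)) (le_trans x1).
  rewrite bisect_pos_le ?a0// x01; split => //.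
  by case: xA => [/andP[_ ->]//|->]; rewrite orbT.
transitivity (lebesgue_measure (`[0, a]%classic : set R)); last first.
  congr lebesgue_measure; apply/seteqP; split => x /=; rewrite !in_itv/=.
    by move=> /andP[-> xa]; rewrite xa (le_trans xa (ltW a1)).
  by move=> [xa /andP[x0 _]]; rewrite x0.
have lambdaE (b : bool) (x y : R) : x <= y ->
    lebesgue_measure [set` Interval (BSide b x) (BRight y)] = (y - x)%:E.
  rewrite lebesgue_measure_itv/= lte_fin le_eqVlt => /predU1P[->|-> //].
  by rewrite ltxx subrr.
have ca0 : 0 <= c * a by rewrite mulr_ge0.
rewrite measureU//; last first.
  apply/seteqP; split => // x /=; rewrite !in_itv/= => -[/andP[_ xc] /andP[cx _]].
  by move: (lt_le_trans cx (le_trans xc caM)); rewrite ltxx.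
apply: etrans (congr2 adde (lambdaE _ _ _ ca0) (lambdaE _ _ _ c1a0)) _.
rewrite lambdaE//; apply: (congr1 EFin).
by rewrite !subr0 (addrC c) addrK mulrBl mul1r addrC subrK.
Qed.
(** * Integrating out an independent variable *)

Section freezing.
Context (R : realType) d d1 d2 (T : measurableType d) (T1 : measurableType d1)
  (T2 : measurableType d2).

(** The finiteness of [m] passes to its image, which Fubini needs; the name
    carries the corresponding structure. *)
Definition image_measure (m : {finite_measure set T -> \bar R})
  (Y : {mfun T >-> T1}) := pushforward m Y.

Section image_measure_finite.
Variables (m : {finite_measure set T -> \bar R}) (Y : {mfun T >-> T1}).

Let image_measure0 : image_measure m Y set0 = 0%E.
Proof. exact: measure0. Qed.

Let image_measure_ge0 A : (0 <= image_measure m Y A)%E.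
Proof. exact: measure_ge0. Qed.

Let image_measure_sigma_additive : semi_sigma_additive (image_measure m Y).
Proof. exact: measure_semi_sigma_additive. Qed.

HB.instance Definition _ := isMeasure.Build _ _ _ (image_measure m Y)
  image_measure0 image_measure_ge0 image_measure_sigma_additive.

Let image_measure_fin : fin_num_fun (image_measure m Y).
Proof.
move=> A mA; apply: fin_num_measure.
by rewrite -[X in measurable X]setTI; exact: measurable_funPT.
Qed.

HB.instance Definition _ :=
  Measure_isFinite.Build _ _ _ (image_measure m Y) image_measure_fin.

End image_measure_finite.

(** If [X] is independent of [Y] then the law of [(Y, X)] is a product, so by
    Tonelli one may integrate over [X] with the value of [Y] frozen.  A finite
    measure [m], instead of a probability, allows restricting to an event; and
    the inner integral has to be known only for the values in a set [S] which
    [Y] almost surely does not leave. *)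
Lemma integral_freezing (m : {finite_measure set T -> \bar R})
    (mu : probability T2 R) (Y : {mfun T >-> T1}) (X : {mfun T >-> T2})
    (S : set T1) (f : T1 * T2 -> \bar R) (g : T1 -> \bar R) :
  (forall A B, measurable A -> measurable B ->
    m (Y @^-1` A `&` X @^-1` B) = (m (Y @^-1` A) * mu B)%E) ->
  measurable_fun setT f -> (forall z, 0 <= f z)%E ->
  measurable_fun setT g -> (forall y, 0 <= g y)%E ->
  {ae m, forall t, S (Y t)} ->
  (forall y, S y -> \int[mu]_x f (y, x) = g y)%E ->
  (\int[m]_t f (Y t, X t) = \int[m]_t g (Y t))%E.
Proof.
move=> mYX mf f0 mg g0 YS fg.
have mZ : measurable_fun [set: T] (fun t => (Y t, X t)).
  exact: measurable_fun_pair.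
pose Z : {mfun T >-> (T1 * T2)%type} := mfun_Sub (mem_set mZ).
transitivity (\int[image_measure m Y \x mu]_z f z)%E.
  rewrite (eq_measure_integral (pushforward m Z)); last first.
    by move=> A mA _; apply: product_measure_unique => // B C mB mC; exact: mYX.
  by rewrite ge0_integral_pushforward.
have mF := @measurable_fun_fubini_tonelli_F _ _ _ _ _ mu _ mf f0.
rewrite fubini_tonelli1// ge0_integral_pushforward//; last first.
  by move=> y _; exact: integral_ge0.
rewrite preimage_setT.
apply: ge0_ae_eq_integral => //.
- exact: measurableT_comp.
- exact: measurableT_comp.
- by move=> t _; exact: integral_ge0.
- by apply: filterS YS => t YtS _; exact: fg.
Qed.

End freezing.

(** One step of the induction.  The event [D] stands for any information on the
    cuts: freezing [Y] under the restriction of [P] to [D], the inner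
    probability is that of [bisect_pos c @^-1` A] for a fixed cut [c], namely
    [mu A] whatever [c] is. *)
Lemma bisect_pos_indep (R : realType) d (T : measurableType d)
    (P : probability T R) (mu : probability R R) (Y X : {mfun T >-> R})
    (D : set T) : uniform01 mu -> measurable D ->
  {ae P, forall t, 0 <= Y t <= 1} ->
  (forall A B, measurable A -> measurable B ->
    P (Y @^-1` A `&` X @^-1` B `&` D) = (P (Y @^-1` A `&` D) * mu B)%E) ->
  forall A, measurable A ->
  P ((fun t => bisect_pos (Y t) (X t)) @^-1` A `&` D) = (mu A * P D)%E.
Proof.
move=> muE mD Y01 indep A mA.
have PD : (P D < +oo)%E by rewrite -ge0_fin_numE// fin_num_measure.
pose m : {finite_measure set T -> \bar R} := mfrestr mD PD.
have mE B : m B = P (B `&` D) by [].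
have mpos := @measurable_bisect_pos R.
have mYX : measurable_fun [set: T] (fun t => bisect_pos (Y t) (X t)).
  exact: (measurableT_comp mpos (measurable_fun_pair (measurable_funPT Y)
    (measurable_funPT X))).
have m_1A : measurable_fun [set: R] (EFin \o \1_A : R -> \bar R).
  by apply/measurable_EFinP; exact: measurable_indic.
have -> : P ((fun t => bisect_pos (Y t) (X t)) @^-1` A `&` D) =
    (\int[m]_t (\1_A (bisect_pos (Y t) (X t)))%:E)%E.
  rewrite (_ : (fun t => _) = (fun t => (\1_((fun t => bisect_pos (Y t) (X t)) @^-1` A) t)%:E)).
    rewrite integral_indic ?setIT//.
    by rewrite -[X in measurable X]setTI; exact: mYX.
  by [].
rewrite (@integral_freezing _ _ _ _ _ _ _ m mu Y X [set c | 0 <= c <= 1]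
  (fun z => (\1_A (bisect_pos z.1 z.2))%:E) (cst (mu A))) //.
- by rewrite integral_cst//; congr (_ * _)%E; apply: etrans (mE _) _; rewrite setTI.
- exact: (measurableT_comp m_1A mpos).
- case: Y01 => N [mN PN0 subN]; exists N; split => //.
  apply/eqP; rewrite -measure_le0 -PN0; exact: measureIl.
- move=> c c01; rewrite -(uniform_bisect_pos muE c01 mA).
  rewrite (_ : (fun x => _) = (fun x => (\1_(bisect_pos c @^-1` A) x)%:E))//.
  rewrite integral_indic ?setIT// -[X in measurable X]setTI.
  exact: (measurableT_comp mpos (measurable_pair1 c)).
Qed.
(** * The expected contraction factor *)

Lemma uniform01_ray (R : realType) (mu : probability R R) (a : R) :
  uniform01 mu -> 0 <= a <= 1 -> mu `]-oo, a]%classic = a%:E.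
Proof.
move=> muE /andP[a0 a1].
apply: etrans (muE _ _) _; first exact: measurable_itv.
have -> : (`]-oo, a] `&` `[0, 1] = `[0, a]%classic :> set R).
  apply/seteqP; split => x /=; rewrite !in_itv/=.
    by move=> [xa /andP[x0 _]]; rewrite x0.
  by move=> /andP[-> xa]; rewrite xa (le_trans xa a1).
rewrite lebesgue_measure_itv/= lte_fin; case: ifPn => [_|].
  by rewrite sube0.
by rewrite -leNgt => a0'; congr EFin; apply/le_anti/andP.
Qed.

(** The absolute value changes nothing for a cut in [[0, 1]]; it makes the
    integrand nonnegative for every real cut, as Tonelli requires. *)
Lemma integral_bisect_factor (R : realType) (mu : probability R R) (c : R) :
  uniform01 mu -> 0 <= c <= 1 ->
  (\int[mu]_r `|bisect_factor c r|%:E = (c ^+ 2 + (1 - c) ^+ 2)%:E)%E.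
Proof.
move=> muE c01; have /andP[c0 c1] := c01.
pose I : set R := `]-oo, c]%classic.
have mI : measurable I by exact: measurable_itv.
have muI : mu I = c%:E by exact: uniform01_ray.
have muIC : mu (~` I) = (1 - c)%:E.
  by rewrite probability_setC// muI EFinB.
have mf : measurable_fun [set: R] (fun r => (`|bisect_factor c r|%:E)).
  apply/measurable_EFinP; apply: measurableT_comp => //.
  exact: (measurableT_comp (@measurable_bisect_factor R) (measurable_pair1 c)).
rewrite -(setvU I) setUC ge0_integral_setU//=; last 3 first.
- exact: measurableC.
- by rewrite setUv.
- by apply/disj_setPCl.
rewrite (eq_integral (cst c%:E)); last first.
  move=> x /[!inE]; rewrite /I/= in_itv/= /bisect_factor => ->.
  by rewrite ger0_norm.
rewrite [X in (_ + X)%E](eq_integral (cst (1 - c)%:E)); last first.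
  move=> x /[!inE]; rewrite /I/= in_itv/= /bisect_factor => /negP/negbTE ->.
  by rewrite ger0_norm// subr_ge0.
rewrite !integral_cst//; last exact: measurableC.
apply: etrans (congr2 adde (congr1 (mule _) muI) (congr1 (mule _) muIC)) _.
by rewrite -!EFinM !expr2.
Qed.

Section bisection_process.
Context (R : realType) d (T : measurableType d) (P : probability T R).
Variables (c_ : nat -> {RV P >-> R}) (mu : probability R R).
Variables (r0 : {RV P >-> R}) (r : nat -> T -> R).
Hypothesis mu_unif : uniform01 mu.
Hypothesis r0_mu : forall A, measurable A -> P (r0 @^-1` A) = mu A.
Hypothesis c_01 : forall n, {ae P, forall t, 0 <= c_ n t <= 1}.
Hypothesis r0_indep : independent_systems P (sigma_of_RV r0) (sigma_of_RVs c_).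
Hypothesis r_init : forall x, r 0%N x = r0 x.
Hypothesis r_step : forall n x, r n.+1 x = bisect_pos (c_ n x) (r n x).

Lemma sigma_of_RVs_measurable (D : set T) : sigma_of_RVs c_ D -> measurable D.
Proof.
move: D; apply: smallest_sub; first exact: sigma_algebra_measurable.
move=> _ [i _ [B mB <-]]; exact: measurable_funPT.
Qed.

Lemma sigma_of_RVs_preimageI n (A : set R) (D : set T) :
  measurable A -> sigma_of_RVs c_ D -> sigma_of_RVs c_ (c_ n @^-1` A `&` D).
Proof.
move=> mA; apply: (@measurableI _
  (g_sigma_algebraType (\bigcup_i sigma_of_RV (c_ i)))).
apply: sub_sigma_algebra; exists n => //; exists A => //.
by rewrite setTI.
Qed.

Lemma measurable_pos n : measurable_fun [set: T] (r n).
Proof.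
elim: n => [|n IH].
  by rewrite (_ : r 0%N = r0)//; apply/funext.
rewrite (_ : r n.+1 = fun t => bisect_pos (c_ n t) (r n t)); last first.
  by apply/funext => t; exact: r_step.
exact: (measurableT_comp (@measurable_bisect_pos R)
  (measurable_fun_pair (measurable_funPT (c_ n)) IH)).
Qed.

(** Independence is claimed with respect to the sigma-algebra of all the cuts,
    past ones included: this makes the induction go through, since the event
    [c_ n @^-1` B] about the cut used at step [n] can be absorbed into [D]. *)
Lemma pos_uniform_indep n (A : set R) (D : set T) :
  measurable A -> sigma_of_RVs c_ D -> P (r n @^-1` A `&` D) = (mu A * P D)%E.
Proof.
elim: n => [|n IH] in A D *.
  move=> mA sD; rewrite (_ : r 0%N = r0); last exact/funext.
  rewrite r0_indep ?r0_mu//.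
  by exists A => //; rewrite setTI.
move=> mA sD; pose X : {mfun T >-> R} := mfun_Sub (mem_set (measurable_pos n)).
rewrite (_ : r n.+1 = fun t => bisect_pos (c_ n t) (X t)); last first.
  by apply/funext => t; exact: r_step.
apply: bisect_pos_indep => //; first exact: sigma_of_RVs_measurable.
move=> B C mB mC; rewrite (setIC (_ @^-1` _)) -setIA IH//.
  by rewrite muleC.
exact: sigma_of_RVs_preimageI.
Qed.

Lemma expectation_factor n :
  ('E_P[fun t => bisect_factor (c_ n t) (r n t)] =
  \int[distribution P (c_ n)]_y (y ^+ 2 + (1 - y) ^+ 2)%:E)%E.
Proof.
pose X : {mfun T >-> R} := mfun_Sub (mem_set (measurable_pos n)).
have mfac := @measurable_bisect_factor R.
have mg : measurable_fun [set: R] (fun y : R => (y ^+ 2 + (1 - y) ^+ 2)%:E).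
  apply/measurable_EFinP; apply: measurable_funD; apply: measurable_funX => //.
  exact: measurable_funB.
have g0 (y : R) : (0 <= (y ^+ 2 + (1 - y) ^+ 2)%:E)%E.
  by rewrite lee_fin addr_ge0// sqr_ge0.
have mf := measurableT_comp mfac (measurable_fun_pair (measurable_funPT (c_ n))
  (measurable_pos n)).
rewrite unlock ge0_integral_distribution//.
transitivity (\int[P]_t `|bisect_factor (c_ n t) (X t)|%:E)%E.
  apply: ae_eq_integral => //.
  - exact/measurable_EFinP.
  - by apply/measurable_EFinP; exact: measurableT_comp.
  apply: filterS (c_01 n) => t /andP[c0 c1] _; congr EFin.
  by rewrite ger0_norm// /bisect_factor; case: ifP; rewrite // subr_ge0.
apply: (@integral_freezing _ _ _ _ _ _ _ P mu (c_ n) X [set c | 0 <= c <= 1]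
  (fun z => `|bisect_factor z.1 z.2|%:E)
  (fun y => (y ^+ 2 + (1 - y) ^+ 2)%:E)) => //.
- move=> A B mA mB; rewrite setIC muleC; apply: pos_uniform_indep => //.
  rewrite -[X in sigma_of_RVs _ X]setIT; apply: sigma_of_RVs_preimageI => //.
  exact: (@measurableT _ (g_sigma_algebraType (\bigcup_i sigma_of_RV (c_ i)))).
- by apply/measurable_EFinP; exact: measurableT_comp.
- exact: c_01.
- by move=> c c01; exact: integral_bisect_factor.
Qed.

End bisection_process.

(** [y ^+ 2 + (1 - y) ^+ 2 = 1/2 + 2 * (y - 1/2) ^+ 2], and a nonnegative
    function of integral zero vanishes almost everywhere. *)
Lemma integral_square_gap (R : realType) d (T : measurableType d)
    (Q : probability T R) (c : {RV Q >-> R}) :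
  let gap := (\int[Q]_x (c x ^+ 2 + (1 - c x) ^+ 2)%:E)%E in
  ((2^-1)%:E <= gap)%E /\
  (gap = (2^-1)%:E <-> {ae Q, forall x, c x = 2^-1}).
Proof.
pose h x := (2 * (c x - 2^-1) ^+ 2)%:E : \bar R.
have h0 x : (0 <= h x)%E by rewrite lee_fin mulr_ge0// sqr_ge0.
have mh : measurable_fun setT h.
  apply/measurable_EFinP; apply: measurable_funM => //.
  apply: measurable_funX; exact: measurable_funB.
have -> : (\int[Q]_x (c x ^+ 2 + (1 - c x) ^+ 2)%:E =
    (2^-1)%:E + \int[Q]_x h x)%E.
  transitivity (\int[Q]_x ((2^-1)%:E + h x))%E.
    by apply: eq_integral => x _; rewrite /h -EFinD; congr EFin; field.
  rewrite ge0_integralD//=.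
  by rewrite integral_cst//; apply: (congr1 (adde^~ _));
    rewrite -[RHS]mule1; congr mule; exact: probability_setT.
split; first by rewrite leeDl// integral_ge0.
have hE : (\int[Q]_x `|h x| = \int[Q]_x h x)%E.
  by apply: eq_integral => x _; rewrite gee0_abs.
have addE0 (y : \bar R) : ((2^-1)%:E + y = (2^-1)%:E -> y = 0)%E.
  case: y => [s [/eqP]|//|//].
  by rewrite -[X in _ == X]addr0 (inj_eq (addrI _)) => /eqP ->.
split=> [/addE0|ae_c].
  rewrite -hE => /ae_eq_integral_abs.
  move=> /(_ measurableT mh); apply: filterS => x /(_ I)[] /eqP.
  by rewrite mulf_eq0 pnatr_eq0/= sqrf_eq0 subr_eq0 => /eqP.
suff -> : (\int[Q]_x h x = 0)%E by rewrite adde0.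
rewrite -hE; apply/ae_eq_integral_abs => //.
by apply: filterS ae_c => x cx _; rewrite /h cx subrr expr0n mulr0.
Qed.

Theorem corollary7 (R : realType)
  (d' : measure_display) (T' : measurableType d') (Q : probability T' R)
  (c : {RV Q >-> R}) (c01 : forall x, 0 <= c x <= 1)
  (d : measure_display) (T : measurableType d) (P : probability T R)
  (c_ : nat -> {RV P >-> R}) (r0 : {RV P >-> R})
  (c_copies : forall n (A : set R), measurable A ->
    distribution P (c_ n) A = distribution Q c A)
  (c_indep : mutually_independent c_)
  (r0_uniform : forall A : set R, measurable A ->
    distribution P r0 A = uniform_prob (@ltr01 R) A)
  (c_r0_indep : independent_systems P (sigma_of_RV r0) (sigma_of_RVs c_))
  (r l : nat -> T -> R)
  (r_init : forall x, r 0%N x = r0 x)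
  (r_step : forall n x, r n.+1 x = bisect_pos (c_ n x) (r n x))
  (l_step : forall n x, l n.+1 x = bisect_factor (c_ n x) (r n x))
  (n : nat) (n_ge1 : (1 <= n)%N) :
  ((2^-1)%:E <= 'E_P[l n])%E /\
  (('E_P[l n] = (2^-1)%:E)%E <-> {ae Q, forall x, c x = 2^-1}).
Proof.
pose mu : probability R R := distribution P r0.
have mu_unif : uniform01 mu.
  move=> A mA; rewrite -uniform_prob01E//; exact: r0_uniform.
have c_01 k : {ae P, forall t, 0 <= c_ k t <= 1}.
  have m01 : measurable (`[0, 1]%classic : set R) by exact: measurable_itv.
  exists (c_ k @^-1` ~` `[0, 1]%classic); split.
  - rewrite -[X in measurable X]setTI.
    by apply: measurable_funPT => //; exact: measurableC.
  - apply: etrans (c_copies k _ (measurableC m01)) _.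
    rewrite /distribution/= /pushforward.
    rewrite (_ : _ @^-1` _ = set0) ?measure0//.
    by apply/seteqP; split => // x /=; rewrite in_itv/= c01.
  - by move=> t /= Ht; rewrite in_itv.
case: n n_ge1 => // k _.
have -> : ('E_P[l k.+1] = \int[Q]_x (c x ^+ 2 + (1 - c x) ^+ 2)%:E)%E.
  rewrite (_ : l k.+1 = fun t => bisect_factor (c_ k t) (r k t)); last first.
    by apply/funext => t; exact: l_step.
  rewrite (@expectation_factor _ _ _ _ c_ mu r0 r)//.
  rewrite (eq_measure_integral (distribution Q c)); last first.
    by move=> A mA _; exact: c_copies.
  rewrite ge0_integral_distribution//.
    apply/measurable_EFinP; apply: measurable_funD; apply: measurable_funX => //.
    exact: measurable_funB.
  by move=> y; rewrite lee_fin addr_ge0// sqr_ge0.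
exact: integral_square_gap.
Qed.
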